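(* Let $\vec G$ be a tree graph or a cycle graph with $n$ vertices and let $D=D_{\vec G}$ be its incidence matrix. Let $S\in\mathcal{S}(D_{\vec G})$ (with $S\neq\emptyset$ if $\vec G$ is a cycle graph) be arbitrary with $n_{\max}=n_{\min}$ and let $x,t>0$. Choose $\lambda\ge\sigma\sqrt{\frac{\log(2n)+t}{r_Sn}}$. Then for all $f\in\mathbb{R}^n$, with probability at least $1-e^{-x}-e^{-t}$, $$\|\hat f-f^0\|_n^2\le\|f-f^0\|_n^2+\frac{\sigma^2}{n}\left(\sqrt{2x}+\sqrt{r_S}\right)^2+4\sigma\sqrt{\frac{\log(2n)+t}{r_Sn}}\,\|Df\|_1 .$$
   Context: Model: $f^0\in\mathbb{R}^n$ is a fixed signal and one observes $Y=f^0+\epsilon$ with $\epsilon\sim\mathcal{N}_n(0,\sigma^2 \mathrm{I}_n)$, $\sigma\in(0,\infty)$. For $f\in\mathbb{R}^n$, $\|f\|_n^2=\sum_{i=1}^n f_i^2/n$. The total variation regularized estimator is $\hat f=\arg\min_{f\in\mathbb{R}^n}\{\|Y-f\|_n^2+2\lambda\|Df\|_1\}$, $\lambda>0$. The incidence matrix of a directed graph $\vec G=([n],\{e_1,\dots,e_m\})$ with edges $e_i=(e_i^-,e_i^+)$ is the matrix $D_{\vec G}\in\{-1,0,1\}^{m\times n}$ whose $i$-th row $d_i'$ has entry $-1$ at $e_i^-$, $+1$ at $e_i^+$ and $0$ elsewhere. A tree graph is a connected graph with $n-1$ edges; the cycle graph is $([n],\{(1,2),\dots,(n-1,n),(n,1)\})$.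 For $S\subseteq[m]$: $-S=[m]\setminus S$; $D_{-S}$ is the submatrix of rows indexed by $-S$. $\mathcal{S}(D)=\{S\subseteq[m]:\exists f\in\mathbb{R}^n,\ S=\{j:d_j'f\ne0\}\}$. $r_S=\dim\mathcal{N}(D_{-S})$ (dimension of the nullspace), which equals the number of connected components of the graph $\vec G_{-S}$ obtained by removing the edges $e_i$, $i\in S$. $n_1,\dots,n_{r_S}$ are the numbers of vertices of these components, $n_{\min}$ and $n_{\max}$ their minimum and maximum.
   Formalization: As printed the claim fails for large λ; the formal theorem has last term 4λ‖Df‖₁ for every λ ≥ σ√((log(2n)+t)/(r_S n)), and the displayed bound with 4σ√((log(2n)+t)/(r_S n))‖Df‖₁ only when λ equals that lower bound. *)

(* Defs.v *)
From HB Require Import structures.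
From mathcomp Require Import all_boot all_order all_algebra.
From mathcomp Require Import all_classical all_reals all_analysis.

Set Implicit Arguments.
Unset Strict Implicit.
Unset Printing Implicit Defensive.

Import Order.TTheory GRing.Theory Num.Theory.
Import numFieldNormedType.Exports.

Local Open Scope ring_scope.

(* A directed graph on the vertices 'I_n with edges e_1, ..., e_m is given by
   e : 'I_m -> 'I_n * 'I_n, where e j is the pair (e_j^-, e_j^+). *)
Section Graph.
Context {n m : nat} (e : 'I_m -> 'I_n * 'I_n).

(* Adjacency, forgetting directions, in the graph keeping only the edges in A. *)
Definition adj (A : {set 'I_m}) : rel 'I_n :=
  fun u v => [exists j in A, (e j == (u, v)) || (e j == (v, u))].

Definition components (A : {set 'I_m}) : {set {set 'I_n}} :=
  [set [set v | connect (adj A) u v] | u : 'I_n].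

Definition is_tree : Prop :=
  m.+1 = n /\ (forall u v : 'I_n, connect (adj [set: 'I_m]) u v).

(* Edges (1,2), ..., (n-1,n), (n,1), with vertices numbered from 0.  For n = 1
   the edge is a loop, and its row in the incidence matrix below is zero. *)
Definition is_cycle : Prop :=
  m = n /\ (forall j : 'I_m, (e j).1 = j :> nat /\ (e j).2 = j.+1 %% n :> nat)%N.

(* Extreme component sizes once the edges in S are removed.  The default value n
   of the minimum is harmless, as no component has more than n vertices. *)
Definition n_max (S : {set 'I_m}) : nat :=
  \max_(C in components (~: S)) #|C|.

Definition n_min (S : {set 'I_m}) : nat :=
  \big[minn/n]_(C in components (~: S)) #|C|.

(* Without loops (e_j^- <> e_j^+), row j is -1 at e_j^-, +1 at e_j^+, else 0. *)
Definition incidence (R : pzRingType) : 'M[R]_(m, n) :=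
  \matrix_(j < m, i < n) ((i == (e j).2)%:R - (i == (e j).1)%:R).

End Graph.

Section Analysis.
Context {R : realType} {n m : nat}.

(* The family S(D) of supports of the vectors D f. *)
Definition is_support (D : 'M[R]_(m, n)) (S : {set 'I_m}) : Prop :=
  exists f : 'cV[R]_n, S = [set j | (D *m f) j 0 != 0]%SET.

(* The submatrix D_{-S}. *)
Definition rows_off (D : 'M[R]_(m, n)) (S : {set 'I_m}) : 'M[R]_(#|~: S|, n) :=
  rowsub (fun k : 'I_#|~: S| => enum_val k) D.

(* kermx is a left kernel, hence the transpose. *)
Definition r_ (D : 'M[R]_(m, n)) (S : {set 'I_m}) : nat :=
  \rank (kermx (rows_off D S)^T).

Definition sqnorm_n (f : 'cV[R]_n) : R := (\sum_(i < n) f i 0 ^+ 2) / n%:R.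

Definition norm1 (g : 'cV[R]_m) : R := \sum_(j < m) `|g j 0|.

Definition tv_objective (D : 'M[R]_(m, n)) (lam : R) (y f : 'cV[R]_n) : R :=
  sqnorm_n (y - f) + 2 * lam * norm1 (D *m f).

Definition is_tv_estimator (D : 'M[R]_(m, n)) (lam : R)
    (fhat : 'cV[R]_n -> 'cV[R]_n) : Prop :=
  forall y f : 'cV[R]_n,
    tv_objective D lam y (fhat y) <= tv_objective D lam y f.

(* sigma * sqrt ((log (2 n) + t) / (r n)) *)
Definition lambda0 (sigma t : R) (r : nat) : R :=
  sigma * Num.sqrt ((ln (2 * n)%:R + t) / (r * n)%:R).

End Analysis.

Arguments lambda0 {R} n sigma t r.

Section Gaussian.
Local Open Scope classical_set_scope.
Context {d : measure_display} {T : measurableType d} {R : realType}.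
Context {P : probability T R} {n : nat}.

Definition mutually_independent (X : 'I_n -> {RV P >-> R}) : Prop :=
  forall (J : {set 'I_n}) (B : 'I_n -> set R),
    (forall i, measurable (B i)) ->
    P (\bigcap_(i in [set` J]) (X i @^-1` B i)) =
    (\prod_(i in J) P (X i @^-1` B i))%E.

(* (eps_1, ..., eps_n) ~ N_n(0, sigma^2 I_n).  The second parameter of
   normal_prob is the standard deviation. *)
Definition is_gaussian_noise (sigma : R) (eps : 'I_n -> {RV P >-> R}) : Prop :=
  mutually_independent eps /\
  (forall (i : 'I_n) (B : set R), measurable B ->
     distribution P (eps i) B = normal_prob 0 sigma B).

End Gaussian.

(* Main.v *)
Require Import Defs.
From HB Require Import structures.
From mathcomp Require Import all_boot all_order all_algebra.
From mathcomp Require Import all_classical all_reals all_analysis.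
From mathcomp Require Import measurable_realfun.
From mathcomp Require Import ring lra zify.

Import Order.TTheory GRing.Theory Num.Theory.
Import numFieldNormedType.Exports.

Set Implicit Arguments.
Unset Strict Implicit.
Unset Printing Implicit Defensive.

Local Open Scope classical_set_scope.
Local Open Scope ring_scope.

(** Write A for the complement of S. The components of the graph with edge set A
    carry the orthonormal family of their normalized indicators; there are [r_ D S]
    of them ([rank_nullspace]), each of n / r vertices since they have equal sizes
    ([balanced_components]).

    The problem is deterministic but for two events. As the penalty is convex and
    the loss quadratic, the objective exceeds its minimum at [f] by at least the
    squared distance from [f] to the minimizer
    ([tv_objective_strong_convexity]). With g = fhat - f and noise z, this gives

      |fhat - f0|^2 + |g|^2 <= |f - f0|^2 + 2 <z, g> + 2 n lam (|D f| - |D fhat|).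

    Split g along the span of the indicators. Twice the inner product of z with the
    part in that span is at most |g|^2, which the left-hand side absorbs, plus the
    squared length of the projected noise. The residual
    part of g is the sum over j in A of (D g)_j V_j for fixed vectors V_j
    ([balanced_residuals]), so once |<V_j, z>| <= n lam for all j in A its
    contribution is at most n lam (|D fhat| + |D f|), and the terms in D fhat cancel
    ([oracle_deterministic]).

    The size of V_j is the only place where the graph matters. In a tree, or in a
    cycle that has lost an edge, every edge j of A is a bridge: some u has
    (D u)_i = [i = j] for all i in A ([tree_cut], [cycle_cut]). The indicator of
    either side of the bridge within its component is such a u up to sign, and the
    smaller side has at most n / (2 r) vertices ([cut_by_small_side]). V_j is a
    projection of that indicator, hence |V_j|^2 <= n / (2 r). A Gaussian tail and a
    union bound over at most n edges and two signs give the term exp (- t)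
    ([gaussian_tail]).

    The projected noise has a chi-square law with r degrees of freedom. The
    exponential moment of its square is computed without rotating the noise:
    exp (c s^2 / 2) is the average of exp (sqrt c Z s) over a standard normal Z, so by
    Tonelli each square is traded for a linear term, and these are handled by the
    moment generating function ([expectation_expR_quad]). The Chernoff bound then
    gives exp (- x) ([chi_square_tail]).

    The estimator is an arbitrary minimizer, but strong convexity makes it 1-Lipschitz
    in the data ([estimator_lipschitz]), so the event of the theorem is measurable
    ([measurable_lipschitz]) and its probability is at least that of the good
    event. *)

(** * Change of variables for weighted measures *)

Section ChangeOfMeasure.
Local Open Scope ereal_scope.
Import HBNNSimple.

Lemma integral_comp_nnsfun d1 d2 (T : measurableType d1) (Y : measurableType d2)
  (R : realType) (mu : {measure set T -> \bar R}) (X : T -> Y) (G : T -> \bar R)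
  (mX : measurable_fun setT X) (mG : measurable_fun setT G)
  (G0 : forall w, 0 <= G w) (h : {nnsfun Y >-> R}) :
  \int[mu]_w ((h (X w))%:E * G w) =
  \sum_(k \in range h) (k%:E * \int[mu]_(w in X @^-1` (h @^-1` [set k])) G w).
Proof.
have mpre (k : R) : measurable (X @^-1` (h @^-1` [set k])).
  by rewrite -[X in measurable X]setTI; exact: mX.
under eq_integral => w _.
  rewrite fimfunE -fsumEFin// ge0_mule_fsuml; last first.
    by move=> k; exact: nnfun_muleindic_ge0.
  over.
rewrite ge0_integral_fsum//; last 2 first.
- move=> k; apply: emeasurable_funM => //; apply/measurable_EFinP.
  apply: measurable_funM => //; apply: (measurableT_comp _ mX).
  exact: measurable_indic.
- by move=> k w _; apply: mule_ge0 => //; exact: nnfun_muleindic_ge0.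
apply: eq_fsbigr => k /[!inE] -[y _ <-].
under eq_integral do rewrite EFinM -muleA.
rewrite ge0_integralZl//; last 3 first.
- apply: emeasurable_funM => //; apply/measurable_EFinP.
  by apply: (measurableT_comp _ mX); exact: measurable_indic.
- by move=> w _; apply: mule_ge0 => //; rewrite lee_fin.
- by rewrite lee_fin.
congr (_ * _); rewrite [RHS]integral_mkcond; apply: eq_integral => w _.
rewrite patchE indicE.
rewrite -[in RHS](_ : (X w \in h @^-1` [set h y]) = (w \in X @^-1` (h @^-1` [set h y]))) //.
by case: (X w \in _); rewrite ?mul1e ?mul0e.
Qed.

(** Weights and maps on two spaces are compared through the image measures they
    induce; agreement on sets passes to nonnegative functions by approximation with
    simple functions. One statement covers both a density (one map being the
    identity) and the removal of an independent factor (one weight being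
    constant). *)
Lemma eq_integral_law d1 d2 d3 (T1 : measurableType d1) (T2 : measurableType d2)
  (Y : measurableType d3) (R : realType)
  (mu1 : {measure set T1 -> \bar R}) (mu2 : {measure set T2 -> \bar R})
  (X1 : T1 -> Y) (X2 : T2 -> Y) (G1 : T1 -> \bar R) (G2 : T2 -> \bar R)
  (mX1 : measurable_fun setT X1) (mX2 : measurable_fun setT X2)
  (mG1 : measurable_fun setT G1) (mG2 : measurable_fun setT G2)
  (G10 : forall w, 0 <= G1 w) (G20 : forall w, 0 <= G2 w) :
  (forall B, measurable B ->
     \int[mu1]_(w in X1 @^-1` B) G1 w = \int[mu2]_(w in X2 @^-1` B) G2 w) ->
  forall h : Y -> R, measurable_fun setT h -> (forall y, (0 <= h y)%R) ->
  \int[mu1]_w ((h (X1 w))%:E * G1 w) = \int[mu2]_w ((h (X2 w))%:E * G2 w).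
Proof.
move=> hB h mh h0.
have mh' : measurable_fun setT (EFin \o h) by exact/measurable_EFinP.
pose g := nnsfun_approx measurableT mh'.
have lim_int d (T : measurableType d) (mu : {measure set T -> \bar R})
    (X : T -> Y) (G : T -> \bar R) :
    measurable_fun setT X -> measurable_fun setT G -> (forall w, 0 <= G w) ->
  \int[mu]_w ((h (X w))%:E * G w) =
  limn (fun k => \int[mu]_w ((g k (X w))%:E * G w)).
  move=> mX mG G0.
  rewrite -monotone_convergence//; last 3 first.
  - move=> k; apply: emeasurable_funM => //.
    by apply/measurable_EFinP; exact: measurableT_comp.
  - by move=> k w _; apply: mule_ge0 => //; rewrite lee_fin.
  - move=> w _ a b ab; apply: lee_wpmul2r => //; rewrite lee_fin.
    exact/lefP/nd_nnsfun_approx.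
  apply: eq_integral => w _; apply/esym/cvg_lim => //.
  have gh : (fun k => (g k (X w))%:E) @ \oo --> (h (X w))%:E.
    by apply: cvg_nnsfun_approx => // y _; rewrite lee_fin.
  have [hw0|hw0] := eqVneq (h (X w)) 0%R.
    (* the approximations vanish where h does, so 0 * +oo never interferes *)
    rewrite hw0 mul0e [X in X @ _ --> _](_ : _ = cst 0); first exact: cvg_cst.
    apply/funext => k /=; suff -> : g k (X w) = 0%R by rewrite mul0e.
    apply/eqP; rewrite eq_le fun_ge0 andbT -lee_fin -hw0.
    rewrite /g nnsfun_approxE; apply: (@le_approx _ _ _ _ (EFin \o h)) => //.
    by move=> y _; rewrite lee_fin.
  apply: cvgeM gh (cvg_cst _).
  by rewrite /mule_def; case: (G w).
rewrite !lim_int//; congr (limn _); apply/funext => k.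
rewrite !integral_comp_nnsfun//; apply: eq_fsbigr => r _.
by rewrite hB.
Qed.
End ChangeOfMeasure.

(** * Expectation of products of independent variables *)

Section Independence.
Local Open Scope ereal_scope.
Context {d : measure_display} {T : measurableType d} {R : realType}.
Context {P : probability T R} {n : nat}.
Variable X : 'I_n -> {RV P >-> R}.
Hypothesis indepX : mutually_independent X.

(** The factors are turned from indicators into arbitrary functions one at a time:
    while the others are kept fixed, both sides are integrals of the k-th factor
    against weighted laws that agree on indicators. *)
Lemma integral_prod_indep (f : 'I_n -> R -> R) :
  (forall i, measurable_fun setT (f i)) -> (forall i y, (0 <= f i y)%R) ->
  \int[P]_w (\prod_(i < n) f i (X i w))%:E =
  \prod_(i < n) \int[P]_w (f i (X i w))%:E.
Proof.
move=> mf f0.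
(* the factors of index at least k are still indicators *)
suff H k : (k <= n)%N -> forall f : 'I_n -> R -> R,
    (forall i, measurable_fun setT (f i)) -> (forall i y, (0 <= f i y)%R) ->
    (forall i : 'I_n, (k <= i)%N -> exists2 B, measurable B & f i = \1_B) ->
    \int[P]_w (\prod_(i < n) f i (X i w))%:E =
    \prod_(i < n) \int[P]_w (f i (X i w))%:E.
  by apply: (H n) => // i; rewrite leqNgt ltn_ord.
elim: k => [_ {mf f0}f mf f0 fB|k IH kn {mf f0}f mf f0 fB].
  pose B i := s2val (cid2 (fB i (leq0n i))).
  have mB i : measurable (B i) by exact: (s2valP (cid2 (fB i (leq0n i)))).
  have fE i : f i = \1_(B i) by exact: (s2valP' (cid2 (fB i (leq0n i)))).
  have mXB i : measurable (X i @^-1` B i).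
    by rewrite -[Y in measurable Y]setTI; exact: measurable_funP.
  transitivity (P (\bigcap_(i in [set` [set: 'I_n]%SET]) (X i @^-1` B i))).
    rewrite -[Y in _ = P Y]setIT -integral_indic//; last first.
      by apply: fin_bigcap_measurable => //; exact: finite_finset.
    apply: eq_integral => w _; congr (_%:E).
    rewrite indicE; case: (boolP (w \in _)).
      rewrite inE => wB; rewrite big1// => i _; rewrite fE indicE mem_set//.
      by apply: wB; rewrite /= inE.
    rewrite notin_setE => /existsNP[i /not_implyP[_ Bi]].
    by rewrite (bigD1 i)//= fE indicE memNset// mul0r.
  rewrite indepX//; apply: eq_big => [i|i _]; first by rewrite inE.
  rewrite -[Y in P Y = _]setIT -integral_indic//; apply: eq_integral => w _.
  by rewrite fE.
pose i0 := Ordinal kn.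
pose G w := (\prod_(i < n | i != i0) f i (X i w))%R.
pose C := \prod_(i < n | i != i0) \int[P]_w (f i (X i w))%:E.
have mfX i : measurable_fun setT (fun w => f i (X i w)).
  by apply: measurableT_comp => //; exact: measurable_funP.
have C0 : 0 <= C.
  apply: prode_ge0 => i _; apply: integral_ge0 => w _.
  by rewrite lee_fin.
rewrite [RHS](bigD1 i0)//= -/C.
under eq_integral do rewrite (bigD1 i0)//= -/(G _) EFinM.
rewrite (@eq_integral_law _ _ _ _ _ _ _ P P (X i0) (X i0) (EFin \o G) (cst C))//.
- rewrite ge0_integralZr//; first exact/measurable_EFinP.
  by move=> w _; rewrite lee_fin.
- apply/measurable_EFinP; rewrite /G.
  under eq_fun do rewrite -big_filter.
  by apply: measurable_prod => i _; exact: mfX.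
- by move=> w; rewrite lee_fin; apply: prodr_ge0 => i _.
move=> B mB.
have mXB : measurable (X i0 @^-1` B).
  by rewrite -[Y in measurable Y]setTI; exact: measurable_funP.
pose f' i := if i == i0 then \1_B : R -> R else f i.
have f'i0 : f' i0 = \1_B by rewrite /f' eqxx.
have f'i i : i != i0 -> f' i = f i by rewrite /f' => /negbTE ->.
have -> : \int[P]_(w in X i0 @^-1` B) (EFin \o G) w =
    \int[P]_w (\prod_(i < n) f' i (X i w))%:E.
  rewrite integral_mkcond; apply: eq_integral => w _.
  rewrite (bigD1 i0)//= f'i0 (eq_bigr (fun i => f i (X i w))); last first.
    by move=> i /f'i ->.
  rewrite -/(G w) patchE indicE.
  rewrite (_ : (X i0 w \in B) = (w \in X i0 @^-1` B))//.
  by case: (w \in _); rewrite ?mul1r ?mul0r.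
rewrite (IH (ltnW kn)); last 3 first.
- by move=> i; have [->|/f'i ->//] := eqVneq i i0; rewrite f'i0.
- by move=> i y; have [->|/f'i ->//] := eqVneq i i0; rewrite f'i0.
- move=> i ki; have [->|ii0] := eqVneq i i0; first by exists B.
  rewrite f'i//; apply: fB; rewrite ltn_neqAle ki andbT.
  by apply: contra ii0 => /eqP ki0; apply/eqP/val_inj.
rewrite (bigD1 i0)//= f'i0.
rewrite (eq_bigr (fun i => \int[P]_w (f i (X i w))%:E)); last first.
  by move=> i /f'i ->.
rewrite -/C muleC integral_cst//; congr (_ * _).
rewrite -[Y in _ = P Y]setIT -integral_indic//.
Qed.
End Independence.

(** * Exponential moments of Gaussian vectors *)

Section GaussianDensity.
Context {R : realType}.
Notation mu := (@lebesgue_measure R).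

(** Completing the square: an exponential tilt of a centered normal density is a
    multiple of a shifted one, whose integral is known. *)
Lemma expR_normal_pdf (sigma a z : R) : sigma != 0 ->
  expR (a * z) * normal_pdf 0 sigma z =
  expR (sigma ^+ 2 * a ^+ 2 / 2) * normal_pdf (sigma ^+ 2 * a) sigma z.
Proof.
move=> s0; rewrite !normal_pdfE// /normal_fun mulrCA [RHS]mulrCA.
congr (_ * _); rewrite -!expRD; congr expR.
by field.
Qed.

Lemma integral_expR_normal_pdf (sigma a : R) : sigma != 0 ->
  (\int[mu]_z (expR (a * z) * normal_pdf 0 sigma z)%:E =
   (expR (sigma ^+ 2 * a ^+ 2 / 2))%:E)%E.
Proof.
move=> s0; under eq_integral do rewrite expR_normal_pdf// EFinM.
rewrite ge0_integralZl//=; last 2 first.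
- by apply/measurable_EFinP; exact: measurable_normal_pdf.
- by move=> z _; rewrite lee_fin normal_pdf_ge0.
by rewrite integral_normal_pdf mule1.
Qed.

(** The parameter is the standard deviation b of the widened Gaussian that the
    integrand is proportional to, which avoids an inverse square root in the
    value. *)
Lemma integral_expR_sqr_normal_pdf (b : R) : 0 < b ->
  (\int[mu]_z (expR ((1 - b ^- 2) / 2 * z ^+ 2) * normal_pdf 0 1 z)%:E = b%:E)%E.
Proof.
move=> b0.
have b1 : b != 0 by rewrite gt_eqF.
transitivity (\int[mu]_z (b%:E * (normal_pdf 0 b z)%:E))%E.
  apply: eq_integral => z _; rewrite -EFinM; congr (_%:E).
  rewrite !normal_pdfE ?oner_neq0// /normal_fun [LHS]mulrCA [RHS]mulrA.
  congr (_ * _).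
    rewrite /normal_peak -!mulrnAr expr1n mul1r sqrtrM ?sqr_ge0//.
    by rewrite sqrtr_sqr (gtr0_norm b0) invfM mulVKf.
  by rewrite -!expRD; congr expR; field.
rewrite ge0_integralZl//=; last 3 first.
- by apply/measurable_EFinP; exact: measurable_normal_pdf.
- by move=> z _; rewrite lee_fin normal_pdf_ge0.
- by rewrite lee_fin ltW.
by rewrite integral_normal_pdf mule1.
Qed.

End GaussianDensity.

Section Dot.
Context {R : realType} {n : nat}.
Implicit Types u v w : 'cV[R]_n.

Definition dot u v : R := \sum_(i < n) u i 0 * v i 0.

Lemma dotC u v : dot u v = dot v u.
Proof. by apply: eq_bigr => i _; rewrite mulrC. Qed.

Lemma dotDl u v w : dot (u + v) w = dot u w + dot v w.
Proof. by rewrite -big_split; apply: eq_bigr => i _; rewrite mxE mulrDl. Qed.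

Lemma dotDr u v w : dot w (u + v) = dot w u + dot w v.
Proof. by rewrite dotC dotDl !(dotC w). Qed.

Lemma dotZl a u v : dot (a *: u) v = a * dot u v.
Proof. by rewrite mulr_sumr; apply: eq_bigr => i _; rewrite mxE mulrA. Qed.

Lemma dotZr a u v : dot u (a *: v) = a * dot u v.
Proof. by rewrite dotC dotZl dotC. Qed.

Lemma dotNl u v : dot (- u) v = - dot u v.
Proof. by rewrite -scaleN1r dotZl mulN1r. Qed.

Lemma dotNr u v : dot u (- v) = - dot u v.
Proof. by rewrite dotC dotNl dotC. Qed.

Lemma dotBB u v : dot (u - v) (u - v) = dot u u - 2 * dot u v + dot v v.
Proof. by rewrite dotDl !dotDr !dotNl !dotNr (dotC v u); ring. Qed.

Lemma dot0l u : dot 0 u = 0.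
Proof. by rewrite -(scale0r 0) dotZl mul0r. Qed.

Lemma dot_suml I (s : seq I) (Q : pred I) (F : I -> 'cV[R]_n) v :
  dot (\sum_(k <- s | Q k) F k) v = \sum_(k <- s | Q k) dot (F k) v.
Proof. by apply: (big_morph (dot^~ v)) => [u w|]; rewrite ?dotDl ?dot0l. Qed.

Lemma dot_ge0 u : 0 <= dot u u.
Proof. by apply: sumr_ge0 => i _; rewrite -expr2 sqr_ge0. Qed.

End Dot.

Section GaussianVector.
Local Open Scope ereal_scope.
Context {d : measure_display} {T : measurableType d} {R : realType}.
Context {P : probability T R} {n : nat} {sigma : R} (sigma0 : (0 < sigma)%R).
Context {eps : 'I_n -> {RV P >-> R}} (epsN : is_gaussian_noise sigma eps).

Definition noise (w : T) : 'cV[R]_n := (\col_(i < n) eps i w)%R.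

Lemma measurable_dot_noise (v : 'cV[R]_n) :
  measurable_fun setT (fun w => dot v (noise w)).
Proof.
apply: measurable_sum => i; under eq_fun do rewrite mxE.
by apply: measurable_funM => //; exact: measurable_funP.
Qed.

Lemma expectation_gaussian (i : 'I_n) (h : R -> R) :
  measurable_fun setT h -> (forall y, (0 <= h y)%R) ->
  \int[P]_w (h (eps i w))%:E =
  \int[lebesgue_measure]_z (h z * normal_pdf 0 sigma z)%:E.
Proof.
move=> mh h0.
transitivity (\int[P]_w ((h (eps i w))%:E * cst 1 w)).
  by apply: eq_integral => w _; rewrite mule1.
rewrite (@eq_integral_law _ _ _ _ _ _ _ P lebesgue_measure (eps i) id
  (cst 1) (fun z => (normal_pdf 0 sigma z)%:E))//.
- by apply/measurable_EFinP; exact: measurable_normal_pdf.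
- by move=> z; rewrite lee_fin normal_pdf_ge0.
move=> B mB; rewrite integral_cst//; last first.
  by rewrite -[Y in measurable Y]setTI; exact: measurable_funP.
by rewrite mul1e; exact: epsN.2.
Qed.

Lemma expectation_expR_dot (v : 'cV[R]_n) :
  \int[P]_w (expR (dot v (noise w)))%:E =
  (expR (sigma ^+ 2 * dot v v / 2))%:E.
Proof.
under eq_integral => w _.
  rewrite /dot expR_sum; under eq_bigr do rewrite mxE.
  over.
have mE i : measurable_fun setT (fun y => expR (v i 0%R * y))%R.
  by apply: measurableT_comp => //; exact: measurable_funM.
rewrite (integral_prod_indep epsN.1 (f := fun i y => expR (v i 0%R * y))%R)//.
under eq_bigr => i _.
  rewrite (expectation_gaussian i (h := fun y => expR (v i 0%R * y))%R)//.
  rewrite integral_expR_normal_pdf ?gt_eqF//.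
  over.
rewrite prodEFin -expR_sum; congr (expR _)%:E.
rewrite /dot mulr_sumr mulr_suml; apply: eq_bigr => i _.
by rewrite expr2.
Qed.

(** Induction on the family: the square of the first coordinate s = <q k, z> is
    linearized by exp (c s^2 / 2) = E exp (sqrt c Z s) with Z standard normal. After
    Tonelli the induction hypothesis applies to v + sqrt c Z q_k, which is still
    orthogonal to the remaining vectors; this is why the linear term v is part of the
    statement. The coefficient is written so that sigma^2 c = 1 - b^-2. *)
Lemma expectation_expR_quad (I : eqType) (q : I -> 'cV[R]_n) (s : seq I)
    (b : R) (v : 'cV[R]_n) :
  (1 <= b)%R -> uniq s ->
  {in s &, forall k l, dot (q k) (q l) = (k == l)%:R} ->
  {in s, forall k, dot (q k) v = 0%R} ->
  \int[P]_w (expR (dot v (noise w)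
     + (1 - b ^- 2) / sigma ^+ 2 / 2 * \sum_(k <- s) dot (q k) (noise w) ^+ 2))%:E =
  (b ^+ size s * expR (sigma ^+ 2 * dot v v / 2))%:E.
Proof.
move=> b1; have b0 : (0 < b)%R by exact: lt_le_trans b1.
set c := ((1 - b ^- 2) / sigma ^+ 2)%R.
have c0 : (0 <= c)%R.
  by rewrite divr_ge0 ?sqr_ge0// subr_ge0 invf_le1 ?exprn_ege1// exprn_gt0.
elim: s v => [v _ _ _|k s IH v /= /andP[ks us] qs vs].
  under eq_integral do rewrite big_nil mulr0 addr0.
  by rewrite expectation_expR_dot expr0 mul1r.
have qs' : {in s &, forall k l, dot (q k) (q l) = (k == l)%:R}.
  by move=> a a' sa sa'; apply: qs; rewrite inE ?sa ?sa' orbT.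
have qk1 : dot (q k) (q k) = 1%R by rewrite qs ?mem_head// eqxx.
pose g w z := (dot (v + (Num.sqrt c * z) *: q k) (noise w)
  + c / 2 * \sum_(l <- s) dot (q l) (noise w) ^+ 2)%R.
have mS : measurable_fun setT (fun w => c / 2 * \sum_(l <- s) dot (q l) (noise w) ^+ 2)%R.
  apply: measurable_funM => //; apply: measurable_sum => l.
  by apply: measurable_funX; exact: measurable_dot_noise.
have mgz z : measurable_fun setT (g^~ z).
  by apply: measurable_funD => //; exact: measurable_dot_noise.
transitivity (\int[P]_w \int[lebesgue_measure]_z (expR (g w z) * normal_pdf 0 1 z)%:E).
  apply: eq_integral => w _.
  rewrite big_cons mulrDr addrCA expRD.
  set t := dot (q k) (noise w); set A := expR (dot v _ + _).
  transitivity (A%:E *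
    \int[lebesgue_measure]_z (expR (Num.sqrt c * t * z) * normal_pdf 0 1 z)%:E).
    rewrite integral_expR_normal_pdf ?oner_neq0// -EFinM mulrC; congr (_ * expR _)%:E.
    by rewrite expr1n mul1r exprMn sqr_sqrtr// mulrAC.
  rewrite -ge0_integralZl//=; last 3 first.
  - apply/measurable_EFinP; apply: measurable_funM.
      by apply: measurableT_comp => //; exact: measurable_funM.
    exact: measurable_normal_pdf.
  - by move=> z _; rewrite lee_fin mulr_ge0 ?expR_ge0 ?normal_pdf_ge0.
  - by rewrite lee_fin expR_ge0.
  apply: eq_integral => z _; rewrite -EFinM mulrA -expRD /g dotDl dotZl -/t.
  by congr (expR _ * _)%:E; ring.
have mg : measurable_fun [set: T * measurableTypeR R]
    (fun p => (expR (g p.1 p.2) * normal_pdf 0 1 p.2)%:E).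
  apply/measurable_EFinP; apply: measurable_funM; last first.
    by apply: (measurableT_comp (measurable_normal_pdf 0 1)).
  apply: measurableT_comp => //; under eq_fun do rewrite /g dotDl dotZl.
  apply: measurable_funD; last exact: (measurableT_comp mS).
  apply: measurable_funD.
    by apply: (measurableT_comp (measurable_dot_noise v)).
  apply: measurable_funM; first exact: measurable_funM.
  by apply: (measurableT_comp (measurable_dot_noise (q k))).
have := fubini_tonelli (m1 := P) (m2 := lebesgue_measure) _ mg.
rewrite /= => -> //; last first.
  by move=> p; rewrite lee_fin mulr_ge0 ?expR_ge0 ?normal_pdf_ge0.
under eq_integral => z _.
  under eq_integral do rewrite EFinM.
  rewrite ge0_integralZr//=; last 2 first.
  - by apply/measurable_EFinP; exact: measurableT_comp.
  - by rewrite lee_fin normal_pdf_ge0.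
  rewrite IH//; last first.
    move=> l sl; rewrite dotDr dotZr vs ?inE ?sl ?orbT// add0r.
    rewrite qs ?inE ?sl ?eqxx ?orbT//.
    by rewrite (negbTE (_ : l != k)) ?mulr0//; apply: contra ks => /eqP <-.
  rewrite dotDl !dotDr !dotZl !dotZr qk1 (vs k) ?mem_head// dotC (vs k) ?mem_head//.
  rewrite [(_ + _)%R](_ : _ = dot v v + c * z ^+ 2)%R; last first.
    by rewrite -[in RHS](sqr_sqrtr c0); ring.
  over.
transitivity (\int[lebesgue_measure]_z
    ((b ^+ size s * expR (sigma ^+ 2 * dot v v / 2))%:E *
     (expR ((1 - b ^- 2) / 2 * z ^+ 2) * normal_pdf 0 1 z)%:E)).
  apply: eq_integral => z _; rewrite -!EFinM !mulrA; congr (_ * _)%:E.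
  rewrite -!mulrA -!expRD; congr (_ * expR _)%R.
  by rewrite /c; field; rewrite !gt_eqF.
rewrite ge0_integralZl//=; last 3 first.
- apply/measurable_EFinP; apply: measurable_funM.
    by apply: measurableT_comp => //; exact: measurable_funM.
  exact: measurable_normal_pdf.
- by move=> z _; rewrite lee_fin mulr_ge0 ?expR_ge0 ?normal_pdf_ge0.
- by rewrite lee_fin mulr_ge0 ?expR_ge0 ?exprn_ge0 ?ltW.
by rewrite integral_expR_sqr_normal_pdf// -EFinM (exprS b) mulrC mulrA.
Qed.

End GaussianVector.

(** * Tail bounds *)

Lemma markov_expR {d : measure_display} {T : measurableType d} {R : realType}
    (P : probability T R) (F : T -> R) (a : R) :
  measurable_fun setT F ->
  (P [set w | (a <= F w)%R] <= (expR (- a))%:E * \int[P]_w (expR (F w))%:E)%E.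
Proof.
move=> mF; rewrite -ge0_integralZl//=; last first.
  by apply/measurable_EFinP; exact: measurableT_comp.
have mA : measurable [set w | a <= F w].
  by rewrite -[Y in measurable Y]setTI; exact: measurable_fun_le.
rewrite -[Y in P Y]setIT -integral_indic//; apply: ge0_le_integral => //.
- by apply/measurable_EFinP; exact: measurable_indic.
- apply/measurable_EFinP; apply: measurable_funM => //.
  exact: measurableT_comp.
move=> w _; rewrite -EFinM lee_fin -expRD indicE.
case: (boolP (w \in _)) => [|_]; last exact: expR_ge0.
by rewrite inE /= => aF; rewrite -[leLHS]expR0 ler_expR addrC subr_ge0.
Qed.

Section Tails.
Context {d : measure_display} {T : measurableType d} {R : realType}.
Context {P : probability T R} {n : nat} {sigma : R} (sigma0 : 0 < sigma).
Context {eps : 'I_n -> {RV P >-> R}} (epsN : is_gaussian_noise sigma eps).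
Local Notation noise := (@noise d T R P n eps).

(** A bound [M] on the squared length, rather than the length itself, keeps the
    vector 0 from being an exception. *)
Lemma gaussian_tail (v : 'cV[R]_n) (M a : R) : 0 < M -> dot v v <= M -> 0 <= a ->
  (P [set w | (a <= dot v (noise w))%R] <=
   (expR (- (a ^+ 2 / (2 * sigma ^+ 2 * M))))%:E)%E.
Proof.
move=> M0 vM a0; have s0 : sigma ^+ 2 * M > 0 by rewrite mulr_gt0// exprn_gt0.
(* the minimizer of the Chernoff exponent - s a + s^2 sigma^2 M / 2 *)
pose s := a / (sigma ^+ 2 * M).
have ss : 0 <= s by rewrite divr_ge0// ltW.
have mD := measurable_dot_noise (eps := eps) (s *: v).
apply: (@le_trans _ _ (P [set w | s * a <= dot (s *: v) (noise w)])).
  apply: le_measure; rewrite ?inE.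
  - rewrite -[Y in measurable Y]setTI; apply: measurable_fun_le => //.
    exact: measurable_dot_noise.
  - by rewrite -[Y in measurable Y]setTI; exact: measurable_fun_le.
  - by move=> w /= av; rewrite dotZl ler_wpM2l.
apply: (le_trans (markov_expR P _ mD)).
rewrite (expectation_expR_dot sigma0 epsN) -EFinM lee_fin -expRD ler_expR.
rewrite dotZl dotZr.
apply: (@le_trans _ _ (- (s * a) + sigma ^+ 2 * (s * (s * M)) / 2)).
  rewrite lerD2l ler_pM2r// ler_wpM2l ?sqr_ge0// ler_wpM2l// ler_wpM2l//.
rewrite /s le_eqVlt; apply/orP; left; apply/eqP; field.
by rewrite !gt_eqF.
Qed.

(** With y = sqrt (2 x / r) the threshold is sigma^2 r (1 + y)^2, and the optimal
    exponent corresponds to b = 1 + y in [expectation_expR_quad]. The Chernoff bound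
    is then (1 + y)^r exp (- r ((1 + y)^2 - 1) / 2), and 1 + y <= exp y leaves
    exp (- r y^2 / 2). *)
Lemma chi_square_tail (I : eqType) (q : I -> 'cV[R]_n) (s : seq I) (x : R) :
  (0 < size s)%N -> uniq s ->
  {in s &, forall k l, dot (q k) (q l) = (k == l)%:R} -> 0 <= x ->
  (P [set w | (sigma ^+ 2 * (Num.sqrt (2 * x) + Num.sqrt (size s)%:R) ^+ 2
              <= \sum_(k <- s) dot (q k) (noise w) ^+ 2)%R] <=
   (expR (- x))%:E)%E.
Proof.
move=> s0 us qs x0; set r : R := (size s)%:R.
have r0 : 0 < r by rewrite ltr0n.
pose y := Num.sqrt (2 * x) / Num.sqrt r; pose b := 1 + y.
have y0 : 0 <= y by rewrite divr_ge0 ?sqrtr_ge0.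
have b1 : 1 <= b by rewrite lerDl.
have b0 : 0 < b by exact: lt_le_trans b1.
set c := (1 - b ^- 2) / sigma ^+ 2.
have c0 : 0 <= c.
  by rewrite divr_ge0 ?sqr_ge0// subr_ge0 invf_le1 ?exprn_ege1// exprn_gt0.
pose F w := dot 0 (noise w) + c / 2 * \sum_(k <- s) dot (q k) (noise w) ^+ 2.
have mS : measurable_fun setT (fun w => \sum_(k <- s) dot (q k) (noise w) ^+ 2).
  by apply: measurable_sum => l; apply: measurable_funX; exact: measurable_dot_noise.
have mF : measurable_fun setT F.
  by apply: measurable_funD; [exact: measurable_dot_noise|exact: measurable_funM].
have thE : sigma ^+ 2 * (Num.sqrt (2 * x) + Num.sqrt r) ^+ 2 = sigma ^+ 2 * (r * b ^+ 2).
  congr (_ * _); rewrite -[in RHS](sqr_sqrtr (ltW r0)) -exprMn /b /y; congr (_ ^+ 2).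
  by rewrite mulrDr mulr1 mulrCA divff ?gt_eqF ?sqrtr_gt0// mulr1 addrC.
rewrite thE.
apply: (@le_trans _ _ (P [set w | r * (b ^+ 2 - 1) / 2 <= F w])).
  apply: le_measure; rewrite ?inE.
  - by rewrite -[Y in measurable Y]setTI; exact: measurable_fun_le.
  - by rewrite -[Y in measurable Y]setTI; exact: measurable_fun_le.
  - move=> w /= av; rewrite /F dot0l add0r.
    rewrite [leLHS](_ : _ = c / 2 * (sigma ^+ 2 * (r * b ^+ 2))).
      by rewrite ler_wpM2l// divr_ge0.
    by rewrite /c; field; rewrite !gt_eqF.
apply: (le_trans (markov_expR P _ mF)).
rewrite (expectation_expR_quad sigma0 epsN b1 us qs); last first.
  by move=> k _; rewrite dotC dot0l.
rewrite dot0l mulr0 mul0r expR0 mulr1 -EFinM lee_fin.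
have y2 : r * y ^+ 2 = 2 * x.
  by rewrite /y expr_div_n (sqr_sqrtr (ltW r0)) sqr_sqrtr ?mulr_ge0// mulrCA divff ?gt_eqF// mulr1.
apply: (@le_trans _ _ (expR (- (r * (b ^+ 2 - 1) / 2)) * expR (r * y))).
  rewrite ler_wpM2l ?expR_ge0// /r expRM_natl.
  by apply: lerXn2r; rewrite ?nnegrE ?expR_ge0 ?(ltW b0)//; exact: expR_ge1Dx.
rewrite -expRD ler_expR /b; nra.
Qed.

End Tails.

(** * Measurability of Lipschitz functions of a random vector *)

Section Lipschitz.
Context {d : measure_display} {T : measurableType d} {R : realType} {n : nat}.

Lemma rational_dense (y : 'cV[R]_n) (e : R) : 0 < e ->
  exists q : 'cV[rat]_n, dot (y - map_mx ratr q) (y - map_mx ratr q) <= e ^+ 2.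
Proof.
move=> e0; pose a := e / n.+1%:R.
have a0 : 0 < a by rewrite divr_gt0.
have H i : exists r : rat, y i 0 - a < ratr r < y i 0 + a.
  have /rat_in_itvoo[r] : y i 0 - a < y i 0 + a by rewrite ltrBlDr -addrA ltrDl addr_gt0.
  by rewrite in_itv /= => ?; exists r.
exists (\col_i xchoose (H i)).
apply: (@le_trans _ _ (\sum_(i < n) a ^+ 2)).
  apply: ler_sum => i _; rewrite !mxE -expr2 -real_normK ?num_real//.
  rewrite lerXn2r ?nnegrE// ?ltW//.
  have /andP[h1 h2] := xchooseP (H i).
  by rewrite ltr_norml; apply/andP; split; lra.
rewrite sumr_const card_ord -mulr_natr /a expr_div_n -mulrA ger_pMr ?exprn_gt0//.
by rewrite mulrC ler_pdivrMr ?exprn_gt0// mul1r -natrX ler_nat; nia.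
Qed.

(** The set where F (Y w) < c is a countable union, over rational points q and radii
    1 / (k + 1) with F q below c by more than the radius, of the events that Y w lies
    in the corresponding ball. *)
Lemma measurable_lipschitz (Y : T -> 'cV[R]_n) (F : 'cV[R]_n -> R) :
  (forall i, measurable_fun setT (fun w => Y w i 0)) ->
  (forall y z, (F y - F z) ^+ 2 <= dot (y - z) (y - z)) ->
  measurable_fun setT (fun w => F (Y w)).
Proof.
move=> mY LF mT; apply: (measurability _ (RGenInftyO.measurableE R)) => //.
move=> _ [_ [c ->] <-]; rewrite setTI.
pose A (p : 'cV[rat]_n * nat) : set T :=
  if F (map_mx ratr p.1) < c - p.2.+1%:R^-1 then
    [set w | dot (Y w - map_mx ratr p.1) (Y w - map_mx ratr p.1) <= p.2.+1%:R ^- 2]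
  else set0.
rewrite (_ : _ @^-1` _ = \bigcup_p A p).
  apply: countable_bigcupT_measurable => [|[q k]]; first exact: countableP.
  rewrite /A /=; case: ifP => // _.
  rewrite -[Y in measurable Y]setTI; apply: measurable_fun_le => //.
  apply: measurable_sum => i; apply: measurable_funM;
    (under eq_fun do rewrite !mxE); exact: measurable_funB.
have bnd (a e : R) : 0 < e -> a ^+ 2 <= e ^+ 2 -> - e <= a <= e.
  by move=> e0 ae; apply/andP; split; nra.
have k0 k : 0 < k.+1%:R^-1 :> R by rewrite invr_gt0.
apply/seteqP; split=> w /=; rewrite in_itv /=.
  move=> Fc.
  have e0 : 0 < (c - F (Y w)) / 2 by rewrite divr_gt0// subr_gt0.
  have [k ke] : exists k, k.+1%:R^-1 < (c - F (Y w)) / 2.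
    exists (Num.bound ((c - F (Y w)) / 2)^-1); rewrite invf_plt ?posrE//.
    apply: lt_trans (archi_boundP _) _; first by rewrite invr_ge0 ltW.
    by rewrite ltr_nat.
  have [q qY] := rational_dense (Y w) (k0 k).
  exists (q, k) => //; rewrite /A /= ifT; first by rewrite -exprVn.
  have /andP[+ _] := bnd _ _ (k0 k) (le_trans (LF _ _) qY).
  by move: ke; set a := k.+1%:R^-1; set b := F (map_mx ratr q); lra.
move=> [[q k] _]; rewrite /A /=; case: ifP => // Fq /=; rewrite -exprVn => Yq.
have /andP[_] := bnd _ _ (k0 k) (le_trans (LF _ _) Yq).
by move: Fq; set a := k.+1%:R^-1; set b := F (map_mx ratr q); lra.
Qed.
End Lipschitz.

(** * The penalized least squares estimator *)

Section Estimator.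
Context {R : realType} {n m : nat} (D : 'M[R]_(m, n)).

Lemma sqnorm_nE (f : 'cV[R]_n) : sqnorm_n f = dot f f / n%:R.
Proof. by rewrite /sqnorm_n /dot; under eq_bigr do rewrite expr2. Qed.

Lemma norm1_convex (s : R) (f g : 'cV[R]_n) : 0 <= s <= 1 ->
  norm1 (D *m (f + s *: (g - f))) <= norm1 (D *m f) + s * (norm1 (D *m g) - norm1 (D *m f)).
Proof.
case/andP => s0 s1; rewrite mulrBr [leRHS](_ : _ = (1 - s) * norm1 (D *m f) + s * norm1 (D *m g)); last by ring.
rewrite !mulr_sumr -big_split; apply: ler_sum => j _ /=.
rewrite mulmxDr -scalemxAr mulmxBr !mxE.
set a := \sum_k _; set b := \sum_k _.
rewrite [X in `|X|](_ : _ = (1 - s) * a + s * b); last by ring.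
apply: le_trans (ler_normD _ _) _.
by rewrite !normrM (ger0_norm s0) ger0_norm// subr_ge0.
Qed.

Lemma le0_of_le_scaled (a b : R) : 0 <= b ->
  (forall s, 0 < s <= 1 -> a <= s * b) -> a <= 0.
Proof.
move=> b0 H; rewrite leNgt; apply/negP => a0.
have ab : 0 < a + b by rewrite ltr_pwDl.
have := H (a / (a + b)); rewrite divr_gt0// ler_pdivrMr// mul1r lerDl => /(_ b0).
by rewrite mulrAC ler_pdivlMr//; nra.
Qed.

Variables (lam : R) (fhat : 'cV[R]_n -> 'cV[R]_n).
Hypotheses (n0 : (0 < n)%N) (lam0 : 0 <= lam) (fhatP : is_tv_estimator D lam fhat).

(** Compare the minimum h with the objective at h + s (f - h): the penalty grows by at
    most s times its increment, the loss by a linear term in s plus s^2 |f - h|^2.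
    Dividing by s and letting s tend to 0 bounds the linear term, which is the
    inequality once the loss at f is expanded around h. *)
Lemma tv_objective_strong_convexity (y f : 'cV[R]_n) :
  tv_objective D lam y (fhat y) + sqnorm_n (f - fhat y) <= tv_objective D lam y f.
Proof.
set h := fhat y; set g := f - h.
have nR : 0 < n%:R :> R by rewrite ltr0n.
pose N (v : 'cV[R]_n) := norm1 (D *m v).
set u := y - h.
suff : 2 * (dot u g / n%:R) - 2 * lam * (N f - N h) <= 0.
  rewrite /tv_objective !sqnorm_nE -/(N f) -/(N h) -/u -/g.
  have -> : y - f = u - g by rewrite /g opprB addrA subrK.
  rewrite (dotBB u g) [(_ - _ + _) / _](_ : _ = dot u u / n%:R - 2 * (dot u g / n%:R) + dot g g / n%:R).
    by move: (dot u u / _) (dot u g / _) (dot g g / _) (N f) (N h) => *; lra.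
  by field; rewrite gt_eqF.
apply: (@le0_of_le_scaled _ (dot g g / n%:R)).
  by rewrite divr_ge0 ?dot_ge0// ltW.
move=> s /andP[s0 s1].
have := fhatP y (h + s *: g); rewrite -/h /tv_objective !sqnorm_nE.
rewrite opprD addrA -/u.
have := norm1_convex h f (s := s); rewrite s1 ltW// => /(_ isT).
rewrite -/g -/(N (h + s *: g)) -/(N f) -/(N h) => Nc.
have {}Nc := ler_wpM2l lam0 Nc.
rewrite (dotBB u (s *: g)) dotZl !dotZr -/u => obj.
rewrite -(ler_pM2l s0); move: obj.
rewrite [(_ - _ + _) / _](_ : _ = dot u u / n%:R - s * (2 * (dot u g / n%:R))
  + s * (s * (dot g g / n%:R))); last by field; rewrite gt_eqF.
move: Nc; move: (dot u u / _) (dot u g / _) (dot g g / _) (N f) (N h) (N _) => *; lra.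
Qed.

(** Adding the strong convexity inequalities at y and z, each tested with the other
    minimizer, cancels the penalties and leaves
    |fhat y - fhat z|^2 <= <y - z, fhat y - fhat z>. *)
Lemma estimator_lipschitz (y z : 'cV[R]_n) :
  dot (fhat y - fhat z) (fhat y - fhat z) <= dot (y - z) (y - z).
Proof.
have v0 : 0 < n%:R^-1 :> R by rewrite invr_gt0 ltr0n.
rewrite -(ler_pM2r v0).
have := lerD (tv_objective_strong_convexity y (fhat z))
             (tv_objective_strong_convexity z (fhat y)).
(* 2 <a, b> <= |a|^2 + |b|^2 with a = y - z and b = fhat y - fhat z *)
have := mulr_ge0 (dot_ge0 ((y - z) - (fhat y - fhat z))) (ltW v0).
rewrite /tv_objective !sqnorm_nE.
move: (fhat y) (fhat z) (n%:R^-1) => h k v.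
have E (a b c e : 'cV[R]_n) : dot (a - b) (c - e) = dot a c - dot a e - dot b c + dot b e.
  by rewrite dotDl !dotDr !dotNl !dotNr; ring.
rewrite !dotBB !E (dotC k h).
move: (norm1 _) (norm1 _).
by move: (dot _ _) (dot _ _) (dot _ _) (dot _ _) (dot _ _) (dot _ _) (dot _ _)
  (dot _ _) (dot _ _) (dot _ _) => *; lra.
Qed.
End Estimator.

(** * Projection off an orthonormal family *)

Section Orthonormal.
Context {R : realType} {n : nat} {I : eqType} (q : I -> 'cV[R]_n) (s : seq I).
Hypotheses (us : uniq s)
  (qs : {in s &, forall k l, dot (q k) (q l) = (k == l)%:R}).

Definition resid (u : 'cV[R]_n) := u - \sum_(k <- s) dot (q k) u *: q k.

Lemma dot_resid u : dot (resid u) (resid u) =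
  dot u u - \sum_(k <- s) dot (q k) u ^+ 2.
Proof.
rewrite /resid dotBB; set p := \sum_(k <- s) _ *: _.
have qp k : k \in s -> dot (q k) p = dot (q k) u.
  move=> sk; rewrite dotC dot_suml (bigD1_seq k)//= dotZl qs// eqxx mulr1.
  rewrite big_seq_cond big1 ?addr0// => l /andP[sl lk].
  by rewrite dotZl qs// (negbTE lk) mulr0.
have pp : dot p p = \sum_(k <- s) dot (q k) u ^+ 2.
  rewrite {1}/p dot_suml !big_seq; apply: eq_bigr => k sk.
  by rewrite dotZl qp// expr2.
have -> : dot u p = dot p p.
  rewrite pp dotC dot_suml; apply: eq_bigr => k _.
  by rewrite dotZl expr2.
by rewrite pp; ring.
Qed.

Lemma dot_resid_le u : dot (resid u) (resid u) <= dot u u.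
Proof.
by rewrite dot_resid lerBlDr lerDl; apply: sumr_ge0 => k _; exact: sqr_ge0.
Qed.

Lemma bessel u : \sum_(k <- s) dot (q k) u ^+ 2 <= dot u u.
Proof. by rewrite -subr_ge0 -dot_resid dot_ge0. Qed.

Lemma residD u v : resid (u + v) = resid u + resid v.
Proof.
rewrite /resid addrACA -opprD -big_split; congr (_ - _).
by apply: eq_bigr => k _; rewrite dotDr scalerDl.
Qed.

Lemma residZ a u : resid (a *: u) = a *: resid u.
Proof.
rewrite /resid scalerBr scaler_sumr; congr (_ - _).
by apply: eq_bigr => k _; rewrite dotZr scalerA.
Qed.

Lemma resid0 : resid 0 = 0.
Proof. by rewrite -(scale0r (0 : 'cV[R]_n)) residZ !scale0r. Qed.

Lemma resid_sum J (r : seq J) (Q : pred J) (F : J -> 'cV[R]_n) :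
  resid (\sum_(k <- r | Q k) F k) = \sum_(k <- r | Q k) resid (F k).
Proof. exact: (big_morph resid residD resid0). Qed.

End Orthonormal.

(** * Components, cuts and the incidence matrix *)

Section Graph.
Context {R : realType} {n m : nat} (e : 'I_m -> 'I_n * 'I_n).
Implicit Types (A : {set 'I_m}) (f : 'cV[R]_n).
Notation D := (incidence e R).

Definition locally_constant A f := forall j, j \in A -> (D *m f) j 0 = 0.

Lemma incidenceE f j : (D *m f) j 0 = f (e j).2 0 - f (e j).1 0.
Proof.
rewrite mxE; under eq_bigr do rewrite mxE mulrBl.
rewrite sumrB; congr (_ - _).
  by rewrite (bigD1 (e j).2)//= eqxx mul1r big1 ?addr0// => i /negbTE ->; rewrite mul0r.
by rewrite (bigD1 (e j).1)//= eqxx mul1r big1 ?addr0// => i /negbTE ->; rewrite mul0r.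
Qed.

Lemma adj_connect_sym A : connect_sym (adj e A).
Proof.
apply: sym_connect_sym => u v.
by apply: eq_existsb => j; rewrite orbC.
Qed.

Lemma adj_edge A j : j \in A -> adj e A (e j).1 (e j).2.
Proof. by move=> Aj; apply/existsP; exists j; rewrite Aj -surjective_pairing eqxx. Qed.

Definition component A u : {set 'I_n} := [set v | connect (adj e A) u v]%SET.

Lemma component_edge A u j : j \in A ->
  ((e j).1 \in component A u) = ((e j).2 \in component A u).
Proof.
move=> /adj_edge/connect1 ej; rewrite !inE.
exact: (same_connect_r (@adj_connect_sym A)).
Qed.

Lemma mem_component A u : u \in component A u.
Proof. by rewrite inE connect0. Qed.

Lemma component_eq A u v : v \in component A u -> component A v = component A u.
Proof.
rewrite inE => uv; apply/setP => w; rewrite !inE.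
by rewrite (same_connect (@adj_connect_sym A) uv).
Qed.

Lemma components_partition A : finset.partition (components e A) [set: 'I_n]%SET.
Proof.
have -> : components e A = equivalence_partition (connect (adj e A)) [set: 'I_n]%SET.
  apply/setP => C; apply/imsetP/imsetP => -[u _ ->]; exists u; rewrite ?inE//;
  by apply/setP => v; rewrite !inE.
apply: equivalence_partitionP => u v w _ _ _; split; first exact: connect0.
by move=> uv; rewrite (same_connect (@adj_connect_sym A) uv).
Qed.

Lemma component_in A u : component A u \in components e A.
Proof. by apply/imsetP; exists u. Qed.

Lemma in_components A C u : C \in components e A -> u \in C -> C = component A u.
Proof. by case/imsetP => v _ -> /component_eq. Qed.

Lemma components_gt0 A C : C \in components e A -> (0 < #|C|)%N.
Proof. by case/imsetP => u _ ->; apply/card_gt0P; exists u; exact: mem_component. Qed.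

Lemma locally_constantP A f u v : locally_constant A f -> v \in component A u ->
  f v 0 = f u 0.
Proof.
move=> fA; rewrite inE => /connectP[p + ->]; elim: p u => //= w p IH u /andP[uw wp].
rewrite (IH w wp); case/existsP: uw => j /andP[/fA].
rewrite incidenceE => /eqP; rewrite subr_eq0 => /eqP fj.
by case/orP => /eqP ej; rewrite ej /= in fj; rewrite fj.
Qed.

Definition indicator (C : {set 'I_n}) : 'cV[R]_n := \col_i (i \in C)%:R.

Lemma dot_indicator C f : dot (indicator C) f = \sum_(i in C) f i 0.
Proof.
rewrite [RHS]big_mkcond; apply: eq_bigr => i _; rewrite mxE.
by case: ifP; rewrite ?mul1r ?mul0r.
Qed.

Lemma incidence_indicator A u j : j \in A ->
  (D *m indicator (component A u)) j 0 = 0.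
Proof.
by move=> Aj; rewrite incidenceE !mxE (component_edge u Aj) subrr.
Qed.

(** With this normalization the components give an orthonormal family, and projecting
    on it is averaging over each component. *)
Definition unit_indicator (C : {set 'I_n}) : 'cV[R]_n :=
  (Num.sqrt #|C|%:R)^-1 *: indicator C.

Lemma unit_indicator_orthonormal A :
  {in enum (components e A) &, forall C C',
    dot (unit_indicator C) (unit_indicator C') = (C == C')%:R}.
Proof.
move=> C C'; rewrite !mem_enum => AC AC'; rewrite dotZl dotZr dot_indicator.
have [<-|CC'] := eqVneq C C'.
  under eq_bigr => i iC do rewrite mxE iC.
  rewrite sumr_const; have C0 : 0 < #|C|%:R :> R by rewrite ltr0n (components_gt0 AC).
  by rewrite mulrA -invfM -expr2 sqr_sqrtr ?ltW// mulVf// gt_eqF.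
rewrite big1 ?mulr0// => i iC; rewrite mxE; case: (boolP (i \in C')) => // iC'.
by rewrite (in_components AC iC) (in_components AC' iC') eqxx in CC'.
Qed.

Lemma resid_locally_constant A f : locally_constant A f ->
  resid unit_indicator (enum (components e A)) f = 0.
Proof.
move=> fA; apply/eqP; rewrite subr_eq0; apply/eqP/matrixP => i k.
rewrite ord1 summxE big_enum /= (bigD1 (component A i)) ?component_in//= big1.
  rewrite addr0 dotZl dot_indicator !mxE mem_component mulr1.
  rewrite (eq_bigr (fun=> f i 0)); last first.
    by move=> v; exact: locally_constantP.
  rewrite sumr_const mulrAC -invfM -expr2 sqr_sqrtr ?ler0n//.
  rewrite -[f i 0 *+ _]mulr_natl mulKf// pnatr_eq0 -lt0n.
  exact: components_gt0 (component_in A i).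
move=> C /andP[AC Ci]; rewrite !mxE.
case: (boolP (i \in C)) => [/(in_components AC) CE|_]; last by rewrite !mulr0.
by rewrite CE eqxx in Ci.
Qed.

(** Any u whose differences vanish on all edges of A but j, where it jumps, is
    constant along paths avoiding j; hence j is a bridge. Removing it splits its
    component in two parts, one of which has at most half of the vertices, and the
    signed indicator of that part has the same differences as u. *)
Lemma cut_by_small_side A (u : 'cV[R]_n) j : j \in A ->
  (forall i, i \in A -> (D *m u) i 0 = (i == j)%:R) ->
  exists2 w : 'cV[R]_n, (forall i, i \in A -> (D *m w) i 0 = (i == j)%:R) &
    2 * dot w w <= #|component A (e j).1|%:R.
Proof.
move=> Aj uj; pose A' := A :\ j.
have A'A i : i \in A' -> i \in A by rewrite !inE => /andP[].
have uA' : locally_constant A' u.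
  by move=> i; rewrite !inE => /andP[ij Ai]; rewrite uj// (negbTE ij).
pose X := component A' (e j).2; pose Y := component A' (e j).1.
have YX : (e j).1 \notin X.
  apply/negP => /(locally_constantP uA') uE; have := uj j Aj.
  by rewrite incidenceE uE eqxx subrr => /esym/eqP; rewrite oner_eq0.
have XY : (e j).2 \notin Y.
  by apply: contra YX => /component_eq; rewrite -/X -/Y => ->; exact: mem_component.
have sub v : component A' v \subset component A v.
  apply/fintype.subsetP => w'; rewrite !inE; apply: connect_sub => a b /existsP[i /andP[iA' ab]].
  by apply/connect1/existsP; exists i; rewrite A'A.
have XYle : (#|X| + #|Y| <= #|component A (e j).1|)%N.
  rewrite -cardsUI [X :&: Y](_ : _ = finset.set0) ?cards0 ?addn0.
    rewrite subset_leq_card// finset.subUset sub// andbT.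
    rewrite [component A (e j).1](_ : _ = component A (e j).2) ?sub//.
    by apply/esym/component_eq; rewrite -component_edge// mem_component.
  apply/setP => v; rewrite [RHS]inE; apply/negP => /setIP[/component_eq vX /component_eq vY].
  by move: YX; rewrite /X -vX vY mem_component.
have dotI C : dot (indicator C) (indicator C) = #|C|%:R.
  rewrite dot_indicator; under eq_bigr => i iC do rewrite mxE iC.
  by rewrite sumr_const.
have small C : (2 * #|C| <= #|component A (e j).1|)%N ->
    2 * #|C|%:R <= #|component A (e j).1|%:R :> R.
  by move=> ?; rewrite -natrM ler_nat.
case: (leqP #|X| #|Y|) => [XleY|YltX].
  exists (indicator X); last by rewrite dotI small//; lia.
  move=> i Ai; have [->|ij] := eqVneq i j.
    by rewrite incidenceE !mxE mem_component (negbTE YX) subr0.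
  by rewrite incidence_indicator// !inE ij.
exists (- indicator Y); last by rewrite dotNl dotNr opprK dotI small//; lia.
move=> i Ai; rewrite mulmxN mxE; have [->|ij] := eqVneq i j.
  by rewrite incidenceE !mxE mem_component (negbTE XY) sub0r opprK.
by rewrite incidence_indicator ?oppr0// !inE ij.
Qed.

Lemma card_component_le (S : {set 'I_m}) u : (#|component (~: S) u| <= n_max e S)%N.
Proof.
rewrite /n_max; apply: (@leq_bigmax_cond _ _ (fun C : {set 'I_n} => #|C|)).
exact: component_in.
Qed.

Lemma balanced_components (S : {set 'I_m}) : n_max e S = n_min e S ->
  (#|components e (~: S)| * n_max e S = n)%N.
Proof.
move=> bal; rewrite -[RHS]card_ord -cardsT (card_partition (components_partition (~: S))).
rewrite -sum_nat_const; apply: eq_bigr => C AC; apply/eqP; rewrite eqn_leq.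
apply/andP; split; last first.
  exact: (@leq_bigmax_cond _ _ (fun C : {set 'I_n} => #|C|)).
rewrite bal /n_min; move: (mem_index_enum C); elim: (index_enum _) => //= C' r IH.
rewrite inE big_cons => /predU1P[<-|rC]; first by rewrite AC geq_minl.
by case: ifP => _; rewrite ?geq_min ?IH ?orbT.
Qed.

(** The normalized indicators of the components, as rows of a matrix B with
    B B^T = 1, are a basis of the nullspace. *)
Lemma rank_nullspace (S : {set 'I_m}) : r_ D S = #|components e (~: S)|.
Proof.
rewrite /r_; set K := kermx _; set A := ~: S.
pose B : 'M[R]_(#|components e A|, n) :=
  \matrix_(a, i) unit_indicator (enum_val a) i 0.
have BB : B *m B^T = 1%:M.
  apply/matrixP => a b; rewrite !mxE.
  transitivity (dot (unit_indicator (enum_val a)) (unit_indicator (enum_val b))).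
    by apply: eq_bigr => i _; rewrite !mxE.
  rewrite (@unit_indicator_orthonormal A) ?mem_enum ?enum_valP//.
  by rewrite (inj_eq enum_val_inj).
have rB : \rank B = #|components e A|.
  by apply/eqP; change (row_free B); apply/row_freeP; exists B^T.
have KP (v : 'rV[R]_n) : (v <= K)%MS <-> locally_constant A v^T.
  rewrite (sameP sub_kermxP eqP) -(inj_eq trmx_inj) trmx_mul trmxK trmx0.
  split=> [/eqP vK j Aj|vA].
    have <- : (rows_off D S *m v^T) (enum_rank_in Aj j) 0 = 0 by rewrite vK mxE.
    rewrite [LHS]mxE [RHS]mxE; apply: eq_bigr => i _.
    by rewrite !mxE enum_rankK_in.
  apply/eqP/matrixP => a b; rewrite ord1 [RHS]mxE -(vA (enum_val a)) ?enum_valP//.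
  by rewrite !mxE; apply: eq_bigr => i _; rewrite !mxE.
rewrite -rB; apply/eqP; rewrite eqn_leq; apply/andP; split; apply: mxrankS.
  apply/row_subP => i; have /KP := row_sub i K; move: (row i K) => v vA.
  have /eqP := resid_locally_constant vA; rewrite subr_eq0 => /eqP vE.
  apply/submxP; exists (\row_a dot (unit_indicator (enum_val a)) v^T).
  apply/matrixP => a b; rewrite ord1; transitivity (v^T b 0); first by rewrite mxE.
  rewrite {1}vE summxE big_enum /= big_enum_val [RHS]mxE; apply: eq_bigr => c _.
  by rewrite !mxE.
apply/row_subP => a; apply/KP => j Aj.
have /imsetP[u _ uE] := enum_valP a.
rewrite [(row a B)^T](_ : _ = unit_indicator (enum_val a)); last first.
  by apply/matrixP => i k; rewrite ord1 !mxE.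
rewrite /unit_indicator -scalemxAr mxE {2}uE -/(component A u).
by rewrite incidence_indicator// mulr0.
Qed.

(** By connectedness the nullspace of the incidence matrix consists of constant
    vectors, so the rank is at least n - 1, the number of rows; u is a column of a right
    inverse. *)
Lemma tree_cut j : is_tree e ->
  exists u : 'cV[R]_n, forall i, (D *m u) i 0 = (i == j)%:R.
Proof.
case=> mn conn.
have rD : (m <= \rank D)%N.
  have : (\rank (kermx D^T) <= 1)%N.
    apply: (@leq_trans (\rank (const_mx 1 : 'rV[R]_n))); last exact: rank_leq_row.
    apply: mxrankS; apply/row_subP => i.
    have /sub_kermxP := row_sub i (kermx D^T); move: (row i _) => v vD.
    have vc : locally_constant [set: 'I_m] v^T.
      move=> k _; have <- : (v *m D^T) 0 k = 0 by rewrite vD mxE.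
      by rewrite [LHS]mxE [RHS]mxE; apply: eq_bigr => l _; rewrite !mxE mulrC.
    apply/submxP; exists (v 0 i)%:M; apply/matrixP => a b.
    rewrite ord1 mul_scalar_mx !mxE mulr1.
    have := locally_constantP (u := i) (v := b) vc; rewrite !mxE; apply.
    by rewrite inE conn.
  rewrite mxrank_ker mxrank_tr; lia.
have /row_freeP[B DB] : row_free D by rewrite /row_free eqn_leq rank_leq_row.
exists (col j B) => i; rewrite colE mulmxA DB mul1mx !mxE.
by rewrite eqxx andbT.
Qed.

(** Removing an edge s of the cycle leaves a path, and removing j as well leaves two
    arcs; u is the signed indicator of the one that avoids the vertex 0, and jumps only
    across j and s. *)
Lemma cycle_cut (S : {set 'I_m}) j : is_cycle e -> S != finset.set0 -> j \in ~: S ->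
  exists u : 'cV[R]_n, forall i, i \in ~: S -> (D *m u) i 0 = (i == j)%:R.
Proof.
move=> [mn ce] /finset.set0Pn[s Ss]; rewrite inE => jS.
have sj : (s != j :> nat) by apply: contra jS => /eqP/val_inj <-.
exists (\col_i (if (j < s)%N then ((j < i) && (i <= s))%N%:R
                 else - ((s < i) && (i <= j))%N%:R)) => i.
rewrite inE => iS; rewrite incidenceE !mxE.
have [-> ->] := ce i.
have si : (s != i :> nat) by apply: contra iS => /eqP/val_inj <-.
have -> : (i == j) = (i == j :> nat) by [].
have im := ltn_ord i. have jm := ltn_ord j. have sm := ltn_ord s.
have sub_bool (a b c : bool) : (a = b + c :> nat)%N -> a%:R - b%:R = c%:R :> R.
  by move=> ->; rewrite natrD addrAC subrr add0r.
have wrap : (i.+1 %% n)%N = (if (i.+1 < n)%N then i.+1 else 0%N).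
  have [i1|i1] := ltnP i.+1 n; first by rewrite modn_small.
  by rewrite (_ : i.+1 = n) ?modnn//; lia.
rewrite wrap; case: (ltnP j s) => js.
  by apply: sub_bool; case: ifP => i1; lia.
rewrite opprK addrC; apply: sub_bool; case: ifP => i1; lia.
Qed.

End Graph.

(** * The oracle inequality on the good event *)

(** The noise along the span of [q] is paid for in full, as a least squares fit on that
    span would; off the span, where a signal is recovered from its increments through
    the [V j], the penalty dominates the noise. *)
Lemma oracle_deterministic {R : realType} {n m : nat} (D : 'M[R]_(m, n))
    (lam K : R) (fhat : 'cV[R]_n -> 'cV[R]_n) (I : eqType) (q : I -> 'cV[R]_n)
    (s : seq I) (A : {set 'I_m}) (V : 'I_m -> 'cV[R]_n) (f0 f z : 'cV[R]_n) :
  (0 < n)%N -> 0 <= lam -> is_tv_estimator D lam fhat ->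
  uniq s -> {in s &, forall k l, dot (q k) (q l) = (k == l)%:R} ->
  (forall g, resid q s g = \sum_(j in A) (D *m g) j 0 *: V j) ->
  \sum_(k <- s) dot (q k) z ^+ 2 <= K ->
  (forall j, j \in A -> `|dot (V j) z| <= n%:R * lam) ->
  sqnorm_n (fhat (f0 + z) - f0) <=
    sqnorm_n (f - f0) + K / n%:R + 4 * lam * norm1 (D *m f).
Proof.
move=> n0 lam0 est us qs dec Kz Vz.
have := tv_objective_strong_convexity n0 lam0 est (f0 + z) f.
set h := fhat _; set g := h - f.
have N0 (u : 'cV[R]_n) : 0 <= norm1 (D *m u) by exact: sumr_ge0.
have decg : g = resid q s g + \sum_(k <- s) dot (q k) g *: q k by rewrite subrK.
have sm : 2 * dot (\sum_(k <- s) dot (q k) g *: q k) z <= K + dot g g.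
  rewrite dot_suml mulr_sumr; apply: le_trans (lerD Kz (bessel us qs g)).
  rewrite -big_split; apply: ler_sum => k _; rewrite dotZl /=.
  by have := sqr_ge0 (dot (q k) z - dot (q k) g); nra.
have rs : dot (resid q s g) z <= n%:R * lam * (norm1 (D *m h) + norm1 (D *m f)).
  rewrite dec dot_suml.
  apply: (@le_trans _ _ (\sum_(j in A) `|(D *m g) j 0| * (n%:R * lam))).
    apply: ler_sum => j Aj; rewrite dotZl; apply: le_trans (ler_norm _) _.
    by rewrite normrM ler_wpM2l// Vz.
  rewrite -mulr_suml mulrC ler_wpM2l ?mulr_ge0//.
  apply: (@le_trans _ _ (\sum_j `|(D *m g) j 0|)).
    rewrite [leRHS](bigID (mem A)) /= lerDl; exact: sumr_ge0.
  rewrite -big_split; apply: ler_sum => j _ /=.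
  by rewrite mulmxBr !mxE; exact: ler_normB.
have zg : dot z g = dot (resid q s g) z + dot (\sum_(k <- s) dot (q k) g *: q k) z.
  by rewrite [in LHS]decg dotDr !(dotC z).
rewrite /tv_objective !sqnorm_nE.
have -> : f0 + z - h = z - (h - f0) by rewrite opprB addrA (addrC z).
have -> : f0 + z - f = z - (f - f0) by rewrite opprB addrA (addrC z).
have -> : f - h = - g by rewrite opprB.
have -> : h - f0 = g + (f - f0) by rewrite /g addrA subrK.
rewrite !dotBB dotNl dotNr opprK (dotDr g _ z).
have nR : 0 < n%:R :> R by rewrite ltr0n.
rewrite -(ler_pM2r nR) => SC; rewrite -(ler_pM2r nR).
move: SC sm rs zg; rewrite !mulrDl !divfK ?gt_eqF//.
move: (dot (g + _) _) (dot g (f - f0)) (dot (f - f0) (f - f0)) (dot z g)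
  (dot z (f - f0)) (dot z z) (dot g g) (norm1 (D *m f)) (norm1 (D *m h))
  (dot (resid q s g) z) (dot (\sum_(k <- s) dot (q k) g *: q k) z) (n%:R).
move=> *; lra.
Qed.

(** * Union bound, measurability and the residual vectors *)

Section UnionBound.
Local Open Scope ereal_scope.

Lemma measure_bigsetU_ord_le d (T : measurableType d) (R : realType)
    (mu : {measure set T -> \bar R}) (m : nat) (B : 'I_m -> set T) (c : R) :
  (forall j, measurable (B j)) -> (forall j, mu (B j) <= c%:E) ->
  mu (\big[setU/set0]_(j < m) B j) <= (c *+ m)%:E.
Proof.
move=> mB Bc; rewrite -[X in (_ *+ X)%R]card_ord -sumr_const -sumEFin.
suff [] : measurable (\big[setU/set0]_(j < m) B j) /\
  mu (\big[setU/set0]_(j < m) B j) <= \sum_(j < m) c%:E by [].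
elim/big_rec2: _ => [|j y A _ [mA Ay]]; first by rewrite measure0.
split; first exact: measurableU.
by apply: (le_trans (measureU2 _ (mB j) mA)); exact: (leeD (Bc j) Ay).
Qed.
End UnionBound.

Lemma measurable_sqnorm_estimator {d : measure_display} {T : measurableType d}
    {R : realType} {n m : nat} (D : 'M[R]_(m, n)) (lam : R)
    (fhat : 'cV[R]_n -> 'cV[R]_n) (Y : T -> 'cV[R]_n) (f0 : 'cV[R]_n) :
  (0 < n)%N -> 0 <= lam -> is_tv_estimator D lam fhat ->
  (forall i, measurable_fun setT (fun w => Y w i 0)) ->
  measurable_fun setT (fun w => sqnorm_n (fhat (Y w) - f0)).
Proof.
move=> n0 lam0 est mY; apply: measurable_funM => //.
apply: measurable_sum => i; apply: measurable_funX.
under eq_fun do rewrite !mxE.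
apply: measurable_funB => //.
apply: (measurable_lipschitz (F := fun y => fhat y i 0) mY) => y z.
apply: le_trans (estimator_lipschitz n0 lam0 est y z).
rewrite /dot (bigD1 i)//= !mxE -expr2 lerDl.
by apply: sumr_ge0 => k _; rewrite -expr2 sqr_ge0.
Qed.

(** V_j is the projection, off the vectors constant on components, of the small-side
    cut W_j. Subtracting from g the sum of the (D g)_j W_j removes all its increments
    on the edges kept, so the difference is constant on components and has residual
    0. Since r components of size [n_max] fill n vertices, the bound [n_max] / 2 on
    |W_j|^2 is n / (2 r). *)
Lemma balanced_residuals {R : realType} {n m : nat} (e : 'I_m -> 'I_n * 'I_n)
    (S : {set 'I_m}) :
  is_tree e \/ (is_cycle e /\ S != finset.set0) -> n_max e S = n_min e S ->
  let r := r_ (incidence e R) S in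
  let s := enum (components e (~: S)) in
  exists V : 'I_m -> 'cV[R]_n,
    (forall j, 2 * r%:R * dot (V j) (V j) <= n%:R) /\
    (forall g, resid unit_indicator s g =
       \sum_(j in ~: S) (incidence e R *m g) j 0 *: V j).
Proof.
move=> hG bal r s; set A := ~: S.
have cut j : j \in A -> exists u : 'cV[R]_n,
    forall i, i \in A -> (incidence e R *m u) i 0 = (i == j)%:R.
  move=> Aj; case: hG => [tr|[cy S0]]; last exact: cycle_cut.
  by have [u uj] := tree_cut (R := R) j tr; exists u.
have orth := unit_indicator_orthonormal (e := e) (A := A) (R := R).
have short j : exists w : 'cV[R]_n,
    (j \in A -> forall i, i \in A -> (incidence e R *m w) i 0 = (i == j)%:R) /\
    2 * dot w w <= (n_max e S)%:R.
  have [Aj|Aj] := boolP (j \in A); last first.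
    by exists 0; split => //; rewrite dot0l mulr0.
  have [u uj] := cut j Aj; have [w wj wle] := cut_by_small_side Aj uj.
  exists w; split => //; apply: le_trans wle _.
  by rewrite ler_nat card_component_le.
have [W WP] := choice short.
exists (fun j => resid unit_indicator s (W j)); split.
  move=> j; have [_ Wle] := WP j.
  rewrite -[leRHS](_ : (r * n_max e S)%:R = n%:R); last first.
    by rewrite /r rank_nullspace balanced_components.
  rewrite natrM mulrAC mulrC ler_wpM2l//; apply: le_trans Wle.
  by rewrite ler_wpM2l// (dot_resid_le (enum_uniq _) orth).
move=> g; pose h := g - \sum_(j in A) (incidence e R *m g) j 0 *: W j.
have hA : locally_constant e A h.
  move=> i Ai.
  have sub_i (M N : 'cV[R]_m) : (M - N) i 0 = M i 0 - N i 0 by rewrite !mxE.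
  have scale_i c (M : 'cV[R]_m) : (c *: M) i 0 = c * M i 0 by rewrite mxE.
  rewrite /h mulmxBr mulmx_sumr sub_i summxE.
  rewrite (bigD1 i)//= big1 ?addr0; last first.
    move=> j /andP[Aj ji]; rewrite -scalemxAr scale_i (WP j).1// eq_sym (negbTE ji).
    by rewrite mulr0.
  by rewrite -scalemxAr scale_i (WP i).1// eqxx mulr1 subrr.
have -> : g = h + \sum_(j in A) (incidence e R *m g) j 0 *: W j by rewrite subrK.
rewrite residD (resid_locally_constant hA) add0r resid_sum.
rewrite subrK; apply: eq_bigr => j _; exact: residZ.
Qed.

(** * The oracle inequality with high probability *)

(* With the tuning parameter lam strictly above its lower bound lambda0, the last
   term of the oracle inequality has to be 4 * lam * norm1 (D *m f), as the
   estimator is then biased by the penalty; for lam = lambda0 this is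
   4 * lambda0 * norm1 (D *m f). *)
Theorem corollary4p9
  (d : measure_display) (T : measurableType d) (R : realType)
  (P : probability T R)
  (n m : nat) (e : 'I_m -> 'I_n * 'I_n)
  (D : 'M[R]_(m, n)) (hD : D = incidence e R)
  (f0 : 'cV[R]_n) (sigma : R) (hsigma : 0 < sigma)
  (eps : 'I_n -> {RV P >-> R}) (heps : is_gaussian_noise sigma eps)
  (S : {set 'I_m})
  (hG : is_tree e \/ (is_cycle e /\ S != finset.set0))
  (hS : is_support D S)
  (hbal : n_max e S = n_min e S)
  (x t : R) (hx : 0 < x) (ht : 0 < t)
  (lam : R) (hlam : lambda0 n sigma t (r_ D S) <= lam)
  (fhat : 'cV[R]_n -> 'cV[R]_n) (hfhat : is_tv_estimator D lam fhat)
  (f : 'cV[R]_n) :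
  let Y (w : T) : 'cV[R]_n := f0 + \col_(i < n) eps i w in
  let oracle_ineq (c : R) : set T :=
    [set w | sqnorm_n (fhat (Y w) - f0) <=
             sqnorm_n (f - f0)
             + sigma ^+ 2 / n%:R
               * (Num.sqrt (2 * x) + Num.sqrt (r_ D S)%:R) ^+ 2
             + 4 * c * norm1 (D *m f)] in
  ((1 - expR (- x) - expR (- t))%:E <= P (oracle_ineq lam))%E
  /\ (lam = lambda0 n sigma t (r_ D S) ->
      ((1 - expR (- x) - expR (- t))%:E
         <= P (oracle_ineq (lambda0 n sigma t (r_ D S))))%E).
Proof.
move=> Y oracle_ineq.
suff H : ((1 - expR (- x) - expR (- t))%:E <= P (oracle_ineq lam))%E.
  by split => // <-.
have [n0 mn] : (0 < n)%N /\ (m <= n)%N.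
  case: hG => [[mn _]|[[mn _] /finset.set0Pn[s _]]]; first lia.
  by have := ltn_ord s; lia.
have nR : 0 < n%:R :> R by rewrite ltr0n.
have [] := balanced_residuals (R := R) hG hbal; rewrite -hD.
set r := r_ D S; set s := enum _ => V [Vle dec].
have us : uniq s by exact: enum_uniq.
have orth := unit_indicator_orthonormal (e := e) (A := ~: S) (R := R).
have rE : r = size s by rewrite /r hD rank_nullspace cardE.
have r0 : (0 < r)%N.
  rewrite rE -cardE; apply/card_gt0P; exists (component e (~: S) (Ordinal n0)).
  exact: component_in.
have rR : 0 < r%:R :> R by rewrite ltr0n.
pose L := ln (2 * n)%:R + t.
have L0 : 0 <= L by rewrite addr_ge0 ?(ltW ht)// ln_ge0// ler1n muln_gt0.
have lam0 : 0 <= lam.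
  by apply: le_trans hlam; rewrite mulr_ge0 ?sqrtr_ge0 ?(ltW hsigma).
pose z w : 'cV[R]_n := noise (eps := eps) w.
pose K := sigma ^+ 2 * (Num.sqrt (2 * x) + Num.sqrt r%:R) ^+ 2.
pose a := n%:R * lambda0 n sigma t r.
have a0 : 0 <= a by rewrite mulr_ge0 ?(ltW nR)// mulr_ge0 ?sqrtr_ge0 ?(ltW hsigma).
pose bad1 := [set w | K <= \sum_(k <- s) dot (unit_indicator k) (z w) ^+ 2].
pose bad2 j := [set w | a <= dot (V j) (z w)] `|` [set w | a <= dot (- V j) (z w)].
pose bad := bad1 `|` \big[setU/set0]_(j < m) bad2 j.
have mdot v : measurable_fun setT (fun w => dot v (z w)) by exact: measurable_dot_noise.
have mle (F : T -> R) c : measurable_fun setT F -> measurable [set w | c <= F w].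
  by move=> mF; rewrite -[X in measurable X]setTI; exact: measurable_fun_le.
have mbad1 : measurable bad1.
  by apply: mle; apply: measurable_sum => k; exact: measurable_funX.
have mbad2 j : measurable (bad2 j) by apply: measurableU; exact: mle.
have mbad : measurable bad by apply: measurableU => //; exact: bigsetU_measurable.
have Pbad1 : (P bad1 <= (expR (- x))%:E)%E.
  rewrite /bad1 /K rE; apply: (chi_square_tail hsigma heps _ us orth (ltW hx)).
  by rewrite -rE.
have Ptail v : 2 * r%:R * dot v v <= n%:R ->
    (P [set w | (a <= dot v (z w))%R] <= (expR (- t) / (2 * n)%:R)%:E)%E.
  move=> vle.
  have M0 : 0 < n%:R / (2 * r%:R) :> R by rewrite divr_gt0// mulr_gt0.
  have vM : dot v v <= n%:R / (2 * r%:R) by rewrite ler_pdivlMr ?mulr_gt0// mulrC.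
  apply: (le_trans (gaussian_tail hsigma heps M0 vM a0)).
  (* |v|^2 <= n / (2 r) and a = n lambda0 make the Gaussian exponent exactly L *)
  rewrite lee_fin (_ : a ^+ 2 / _ = L); last first.
    rewrite /a /lambda0 -/L !exprMn sqr_sqrtr ?divr_ge0// natrM.
    by field; rewrite !gt_eqF.
  rewrite /L opprD expRD [expR (- ln _)]expRN lnK ?posrE ?ltr0n ?muln_gt0//.
  by rewrite mulrC.
have Pbad2 : (P (\big[setU/set0]_(j < m) bad2 j) <= (expR (- t))%:E)%E.
  apply: (le_trans (measure_bigsetU_ord_le (c := expR (- t) / n%:R) mbad2 _)).
    move=> j; apply: (le_trans (measureU2 _ _ _)); try exact: mle.
    rewrite (_ : expR (- t) / n%:R = expR (- t) / (2 * n)%:R + expR (- t) / (2 * n)%:R); last first.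
      by rewrite natrM; field; rewrite gt_eqF.
    rewrite EFinD; apply: leeD; apply: Ptail => //.
    by rewrite dotNl dotNr opprK.
  rewrite lee_fin -[_ *+ m]mulr_natr -mulrA ler_piMr ?expR_ge0//.
  by rewrite mulrC ler_pdivrMr// mul1r ler_nat.
have mOr : measurable (oracle_ineq lam).
  rewrite -[X in measurable X]setTI; apply: measurable_fun_le => //.
  apply: (measurable_sqnorm_estimator f0 n0 lam0 hfhat) => i.
  by under eq_fun do rewrite !mxE; apply: measurable_funD => //.
have sub : ~` bad `<=` oracle_ineq lam.
  move=> w /not_orP[/negP]; rewrite -ltNge => /ltW Kw nb2.
  rewrite /oracle_ineq /= (_ : sigma ^+ 2 / n%:R * _ = K / n%:R); last first.
    by rewrite /K mulrAC.
  apply: (oracle_deterministic f0 f n0 lam0 hfhat us orth dec Kw).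
  move=> j Aj; apply: (@le_trans _ _ a); last by rewrite ler_wpM2l// ltW.
  rewrite leNgt; apply/negP; rewrite real_ltr_normr ?num_real// => /orP[] /ltW aV; apply: nb2;
    rewrite (bigD1 j)//=; left; first by left.
  by right; rewrite /= dotNl.
apply: (@le_trans _ _ (P (~` bad))); last first.
  by apply: le_measure; rewrite ?inE//; exact: measurableC.
rewrite probability_setC//.
have Pbad : (P bad <= (expR (- x) + expR (- t))%:E)%E.
  apply: (le_trans (measureU2 _ _ _)) => //; last by rewrite EFinD; exact: leeD.
  exact: bigsetU_measurable.
have -> : (1 - expR (- x) - expR (- t))%:E = (1 - (expR (- x) + expR (- t))%:E)%E.
  by rewrite -EFinB opprD addrA.
exact: leeB.
Qed.
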